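(* Let $m\ge 2$ and $\ell\ge 1$ be integers, let $\varphi=\frac{1+\sqrt5}{2}$, and define \[ \alpha=\sqrt{\frac{(1-\frac1m)(\ell+1)\varphi^2}{(1-\frac1m)(\ell+1)\varphi^2+2\ell}},\qquad \beta=\frac{1-\alpha}{\ell}, \] \[ y_i=\frac{\varphi(\alpha+i\beta)}{\alpha},\qquad x_i=1+\frac1{y_i}\qquad (i=0,1,\dots,\ell). \] For $i=0,1,\dots,\ell$ let $A_i$ be the deterministic online algorithm that, for each arriving job $J_j$: if $r_j\le x_i$ or $\varphi<r_j\le y_i$, assigns $J_j$ untested to a currently least loaded machine; otherwise tests $J_j$ and assigns it to a currently least loaded machine. Let GCL be the randomized algorithm that runs $A_0$ with probability $\alpha$ and each $A_i$, $i=1,\dots,\ell$, with probability $\beta$. Then, for the online multiprocessor scheduling with testing problem on $m$ machines, the expected competitive ratio of GCL is at most \[ \sqrt{\Big(1-\frac1m\Big)^2\Big(1+\frac1\ell\Big)^2\varphi^2+2\Big(1-\frac1m\Big)\Big(1+\frac1\ell\Big)}+1-\Big(1-\frac1m\Big)\frac{\varphi}{\ell}. \]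
   Context: Online multiprocessor scheduling with testing ($P\mid online, t_j, 0\le p_j\le u_j\mid C_{\max}$): there are $m$ identical parallel machines and jobs $J_1,\dots,J_n$ arriving one by one in this order. When $J_j$ arrives, an upper bound $u_j\ge0$ and a testing time $t_j\ge0$ are revealed; its processing time $p_j\in[0,u_j]$ is unknown. Upon arrival the algorithm must irrevocably decide whether to test $J_j$ and on which machine to process it. An untested job occupies its machine for $u_j$ time; a tested job occupies it for $t_j+p_j$ time, and $p_j$ is revealed after testing. Processing is non-preemptive; the load of a machine is the total time of the jobs assigned to it, and the makespan $C$ is the maximum machine load. A least loaded machine is one of minimum current load (ties broken arbitrarily). Let $\rho_j=\min\{u_j,t_j+p_j\}$; the optimal offline makespan $C^*(I)$ of an instance $I$ is the minimum, over all assignments of jobs to machines, of the maximum over machines of the sum of $\rho_j$ over jobs assigned to it. A randomized algorithm is a probability distribution over deterministic algorithms; its expected competitive ratio is $\sup_I E[C(I)]/C^*(I)$ over all instances $I$. The ratio of a job is $r_j=u_j/t_j$ (with $r_j=+\infty$ if $t_j=0<u_j$, and $r_j=0$ if $u_j=t_j=0$). *)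

(* Defs.v *)
From HB Require Import structures.
From mathcomp Require Import all_boot all_order all_algebra.
From mathcomp Require Import boolp classical_sets reals constructive_ereal ereal.

Set Implicit Arguments.
Unset Strict Implicit.
Unset Printing Implicit Defensive.

Import Order.TTheory GRing.Theory Num.Theory.
Local Open Scope ring_scope.

Section Instances.
Variable R : realType.

Record job := Job { upper : R; test_time : R; proc : R }.

Definition valid_job (j : job) : bool :=
  [&& 0 <= upper j, 0 <= test_time j, 0 <= proc j & proc j <= upper j].

(* Jobs in order of arrival. *)
Definition instance := seq job.

Definition valid_instance (I : instance) : bool := all valid_job I.

Definition rho (j : job) : R := Num.min (upper j) (test_time j + proc j).

Definition assignment_makespan (m : nat) (I : instance)
    (s : {ffun 'I_(size I) -> 'I_m}) : R :=
  \big[Num.max/0]_(k < m)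
     \sum_(i < size I | s i == k) rho (tnth (in_tuple I) i).

(* For 0 < m this is the infimum of a finite nonempty set, hence a minimum:
   see opt_attained. *)
Definition opt (m : nat) (I : instance) : R :=
  inf (range (@assignment_makespan m I)).

Lemma opt_attained (m : nat) (I : instance) : (0 < m)%N ->
  exists2 s, opt m I = @assignment_makespan m I s
    & forall s', @assignment_makespan m I s <= @assignment_makespan m I s'.
Proof.
move=> m0; pose s0 : {ffun 'I_(size I) -> 'I_m} := [ffun=> Ordinal m0].
case: (@arg_minP _ R _ s0 xpredT (@assignment_makespan m I)) => // s _ smin.
have smin' s' : @assignment_makespan m I s <= @assignment_makespan m I s'.
  exact: smin.
exists s => //; apply/eqP; rewrite eq_le; apply/andP; split.
  by apply: ge_inf; [exists (@assignment_makespan m I s) => _ [s' _ <-] | exists s].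
apply: lb_le_inf; first by exists (@assignment_makespan m I s); exists s.
by move=> _ [s' _ <-].
Qed.

(* What an online algorithm on m machines knows about a job it has already
   handled: revealed is Some p if the job was tested and turned out to have
   processing time p, and None if it was not tested. *)
Record event (m : nat) := Event {
  ev_upper : R; ev_test_time : R; revealed : option R; machine : 'I_m }.

Definition occupation (m : nat) (e : event m) : R :=
  if revealed e is Some p then ev_test_time e + p else ev_upper e.

Definition history (m : nat) := seq (event m).

Definition load (m : nat) (h : history m) (k : 'I_m) : R :=
  \sum_(e <- h | machine e == k) occupation e.

Definition makespan (m : nat) (h : history m) : R :=
  \big[Num.max/0]_(k < m) load h k.

(* From the history and the pair u, t of the arriving job, a deterministic
   online algorithm decides whether to test the job and on which machine to
   process it, without knowing p. *)
Definition online_alg (m : nat) := history m -> R -> R -> bool * 'I_m.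

Fixpoint run_from (m : nat) (A : online_alg m) (h : history m) (I : instance) :
    history m :=
  if I is j :: I' then
    let d := A h (upper j) (test_time j) in
    let e := Event (upper j) (test_time j)
               (if d.1 then Some (proc j) else None) d.2 in
    run_from A (rcons h e) I'
  else h.

Definition cost (m : nat) (A : online_alg m) (I : instance) : R :=
  makespan (run_from A [::] I).

(* A finitely supported probability distribution over deterministic online
   algorithms. *)
Record randomized_alg (m : nat) := RandomizedAlg {
  support : finType;
  weight : support -> R;
  algorithm : support -> online_alg m;
  weight_ge0 : forall i, 0 <= weight i;
  weight_sum1 : \sum_i weight i = 1 }.

Definition expected_cost (m : nat) (A : randomized_alg m) (I : instance) : R :=
  \sum_i weight i * cost (algorithm (r := A) i) I.

(* In \bar R, division gives 0 / 0 = 0 and c / 0 = +oo for c > 0. *)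
Definition expected_competitive_ratio (m : nat) (A : randomized_alg m) : \bar R :=
  ereal_sup [set ((expected_cost A I)%:E / (opt m I)%:E)%E
            | I in [set I | valid_instance I]]%classic.

Definition job_ratio (u t : R) : \bar R :=
  if t == 0 then (if u == 0 then 0%E else +oo%E) else (u / t)%:E.

(* A tie-breaking rule: a choice of a least loaded machine. *)
Definition selector (m : nat) := history m -> R -> R -> 'I_m.

Definition least_loaded (m : nat) (sel : selector m) : Prop :=
  forall h u t k, load h (sel h u t) <= load h k.

End Instances.

Section GCL.
Variable R : realType.

Definition phi : R := (1 + Num.sqrt 5) / 2.

Variables m l : nat.

Definition alpha : R :=
  Num.sqrt ((1 - m%:R^-1) * (l%:R + 1) * phi ^+ 2 /
            ((1 - m%:R^-1) * (l%:R + 1) * phi ^+ 2 + 2 * l%:R)).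

Definition beta : R := (1 - alpha) / l%:R.

Definition y_ (i : nat) : R := phi * (alpha + i%:R * beta) / alpha.

Definition x_ (i : nat) : R := 1 + (y_ i)^-1.

Definition leaves_untested (i : nat) (u t : R) : bool :=
  let r := job_ratio u t in
  (r <= (x_ i)%:E)%E || ((phi%:E < r)%E && (r <= (y_ i)%:E)%E).

Definition A_ (i : nat) (sel : selector R m) : online_alg R m :=
  fun h u t => (~~ leaves_untested i u t, sel h u t).

Definition gcl_weight (i : 'I_l.+1) : R := if i == ord0 then alpha else beta.

Lemma alpha_le1 : alpha <= 1.
Proof.
rewrite /alpha -[leRHS]sqrtr1 ler_wsqrtr //.
set a := _ * phi ^+ 2.
have a0 : 0 <= a.
  apply: mulr_ge0 (sqr_ge0 _); apply: mulr_ge0; last first.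
    by rewrite addr_ge0 ?ler0n.
  rewrite subr_ge0.
  by case: m => [|k]; rewrite ?invr0 ?ler01// invf_le1 ?ltr0n// ler1n.
have b0 : 0 <= 2 * l%:R :> R by rewrite mulr_ge0 ?ler0n.
have := addr_ge0 a0 b0; rewrite le_eqVlt => /predU1P[<-|ab0].
  by rewrite invr0 mulr0 ler01.
by rewrite ler_pdivrMr// mul1r lerDl.
Qed.

Lemma gcl_weight_ge0 i : 0 <= gcl_weight i.
Proof.
rewrite /gcl_weight; case: ifP => _; first exact: sqrtr_ge0.
by apply: divr_ge0; rewrite ?ler0n// subr_ge0 alpha_le1.
Qed.

Lemma gcl_weight_sum1 : (1 <= l)%N -> \sum_i gcl_weight i = 1.
Proof.
move=> l1; rewrite big_ord_recl /gcl_weight eqxx.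
rewrite (eq_bigr (fun=> beta)); last by [].
rewrite sumr_const card_ord -[beta *+ l]mulr_natr divfK ?pnatr_eq0 -?lt0n//.
by rewrite addrC subrK.
Qed.

Definition GCL (l1 : (1 <= l)%N) (sel : 'I_l.+1 -> selector R m) :
    randomized_alg R m :=
  RandomizedAlg (fun i : 'I_l.+1 => A_ i (sel i))
    gcl_weight_ge0 (gcl_weight_sum1 l1).

End GCL.

(* Main.v *)
(* List scheduling with job costs q_j <= M has makespan at most
   (1/m) sum_j q_j + (1 - 1/m) M.  Algorithm A_i pays at most y_i rho_j for job
   J_j, so one can take M = y_i C*.  The thresholds are such that the A_i which
   leave a job of ratio at most phi untested, and the A_i which test a job of
   larger ratio, form an initial segment {0, ..., i} of total probability
   alpha + i beta; from this the expected cost of J_j under GCL is at most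
   (1 + alpha/phi) rho_j.  As C* is at least the average of the rho_j, the ratio
   is at most 1 + alpha/phi + (1 - 1/m) E[y_i], and alpha is the minimiser of
   this expression. *)
Require Import Defs.
From mathcomp Require Import all_boot all_order all_algebra.
From mathcomp Require Import boolp classical_sets reals constructive_ereal ereal.
From mathcomp Require Import ring lra.
Set Implicit Arguments.
Unset Strict Implicit.

Import Order.TTheory GRing.Theory Num.Theory.
Local Open Scope ring_scope.

(** * List scheduling with bounded job costs *)

Lemma sum_load (R : realType) (m : nat) (h : history R m) :
  \sum_(k < m) load h k = \sum_(e <- h) occupation e.
Proof. by rewrite /load (partition_big (@machine R m) xpredT). Qed.

Lemma load_rcons (R : realType) (m : nat) (h : history R m) e k :
  load (rcons h e) k = load h k + (if machine e == k then occupation e else 0).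
Proof.
by rewrite /load -cats1 big_cat; congr (_ + _); rewrite big_mkcond big_seq1.
Qed.

Lemma least_load_le_average (R : realType) (m : nat) (h : history R m) k0 :
  (forall k, load h k0 <= load h k) ->
  load h k0 <= m%:R^-1 * \sum_(e <- h) occupation e.
Proof.
move=> least; have m0 : 0 < m%:R :> R by rewrite ltr0n (leq_trans _ (ltn_ord k0)).
rewrite ler_pdivlMl// -sum_load mulr_natl -[X in _ *+ X]card_ord -sumr_const.
by apply: ler_sum => k _.
Qed.

(** For algorithms whose testing decision ignores the history, the time occupied by a job depends on
    the job alone and not on the schedule. *)
Definition processing_cost (R : realType) (tests : R -> R -> bool) (j : job R) : R :=
  if tests (upper j) (test_time j) then test_time j + proc j else upper j.

Section ListScheduling.
Variables (R : realType) (m : nat) (A : online_alg R m) (tests : R -> R -> bool).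
Hypothesis m_gt0 : (0 < m)%N.
Hypothesis A_tests : forall h u t, (A h u t).1 = tests u t.
Hypothesis A_least : forall h u t k, load h (A h u t).2 <= load h k.

(** Invariant of the greedy rule. A job of cost [q] goes to a machine of load at most the average
    [S / m], and [S / m + q = (S + q) / m + (1 - 1 / m) * q] with [q <= M]. On the other machines
    the bound only grows, as [0 <= q]. *)
Lemma load_run_from (M : R) (h : history R m) (I : instance R) :
  all (fun j => 0 <= processing_cost tests j <= M) I ->
  (forall k, load h k <=
     m%:R^-1 * (\sum_(e <- h) occupation e) + (1 - m%:R^-1) * M) ->
  forall k, load (run_from A h I) k <=
    m%:R^-1 * (\sum_(e <- h) occupation e + \sum_(j <- I) processing_cost tests j)
    + (1 - m%:R^-1) * M.
Proof.
elim: I h => [|j I IH] h /=; first by rewrite big_nil addr0.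
move=> /andP[/andP[q0 qM] allI] loadh; set e := Event _ _ _ _.
have occe : occupation e = processing_cost tests j.
  by rewrite /occupation /= A_tests /processing_cost; case: tests.
have mV0 : 0 <= m%:R^-1 :> R by rewrite invr_ge0.
have mV1 : m%:R^-1 <= 1 :> R by rewrite invf_le1 ?ler1n ?ltr0n.
have sume : \sum_(e <- rcons h e) occupation e =
    \sum_(e <- h) occupation e + processing_cost tests j.
  by rewrite -cats1 big_cat big_seq1 /= occe.
move=> k; rewrite big_cons addrA -sume.
apply: IH => // {}k; rewrite load_rcons sume occe.
case: eqP => [<-|_]; last by have := loadh k; nra.
have := least_load_le_average (A_least h (upper j) (test_time j)).
move: (load _ _) (\sum_(_ <- h) _) => L S LS; rewrite /=; nra.
Qed.

Lemma cost_list_scheduling (M : R) (I : instance R) : 0 <= M ->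
  all (fun j => 0 <= processing_cost tests j <= M) I ->
  cost A I <= m%:R^-1 * (\sum_(j <- I) processing_cost tests j)
              + (1 - m%:R^-1) * M.
Proof.
move=> M0 allI.
have mV0 : 0 <= m%:R^-1 :> R by rewrite invr_ge0.
have mV1 : m%:R^-1 <= 1 :> R by rewrite invf_le1 ?ler1n ?ltr0n.
(* The makespan is a maximum with default value 0, so the bound itself must be nonnegative. *)
have sum0 : 0 <= \sum_(j <- I) processing_cost tests j.
  elim: I allI => [|j I IH] /=; first by rewrite big_nil.
  by rewrite big_cons => /andP[/andP[? _] /IH]; apply: addr_ge0.
rewrite /cost /makespan; apply/bigmax_leP; split=> [|k _]; first by nra.
have := @load_run_from M [::] I allI; rewrite big_nil add0r; apply=> {}k.
by rewrite /load big_nil mulr0 add0r mulr_ge0// subr_ge0.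
Qed.

End ListScheduling.

(** * Lower bounds on the optimal makespan *)

Section Opt.
Variables (R : realType) (m : nat) (I : instance R).
Hypotheses (m_gt0 : (0 < m)%N) (validI : valid_instance I).

Lemma rho_ge0 (j : job R) : valid_job j -> 0 <= rho j.
Proof. by case/and4P => *; rewrite /rho le_min addr_ge0 ?andbT. Qed.

Lemma rho_tnth_ge0 (i : 'I_(size I)) : 0 <= rho (tnth (in_tuple I) i).
Proof. by apply: rho_ge0; move/(all_tnthP (t := in_tuple I)): validI; apply. Qed.

Lemma average_rho_le_opt : m%:R^-1 * \sum_(j <- I) rho j <= opt m I.
Proof.
have [s -> _] := opt_attained I m_gt0.
rewrite ler_pdivrMl ?ltr0n// big_tnth (partition_big s xpredT)//=.
rewrite mulr_natl -[X in _ *+ X]card_ord -sumr_const.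
apply: ler_sum => k _; exact: le_bigmax.
Qed.

Lemma rho_le_opt : all (fun j => rho j <= opt m I) I.
Proof.
have [s -> _] := opt_attained I m_gt0.
apply/(all_tnthP (t := in_tuple I)) => i.
apply: (le_trans _ (le_bigmax _ _ (s i))).
rewrite (bigD1 i)//= lerDl sumr_ge0// => i' _; exact: rho_tnth_ge0.
Qed.

Lemma opt_ge0 : 0 <= opt m I.
Proof.
by have [s -> _] := opt_attained I m_gt0; exact: bigmax_ge_id.
Qed.

End Opt.

(** * Initial segments of indices, and two polynomial inequalities *)

Lemma prefix_threshold (P : pred nat) (n : nat) : P 0%N ->
  (forall i j, (i <= j)%N -> P j -> P i) ->
  exists2 i, (i <= n)%N & forall j, (j <= n)%N -> P j = (j <= i)%N.
Proof.
move=> P0 Pmono; pose Q i := (i <= n)%N && P i.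
have exQ : exists i, Q i by exists 0%N.
have Qn i : Q i -> (i <= n)%N by case/andP.
(* The threshold is the largest index up to [n] satisfying [P]; [P 0] guarantees that one exists. *)
case: (ex_maxnP exQ Qn) => i /andP[il Pi] imax; exists i => // j jn.
by apply/idP/idP => [Pj|/Pmono]; [apply: imax; rewrite /Q jn|apply].
Qed.

(** Here [p], [a], [b] stand for [phi], [alpha], [beta], and [d] for [alpha + i beta]. Each factor
    is replaced by its crudest bound, [1 - d <= 1 - a] and [d + b <= 1]; this needs [a] near 7/10,
    which holds for [l <= 2]. *)
Lemma step_bound_small (F : realFieldType) (p a b d : F) :
  p ^+ 2 = p + 1 -> 8 / 5 < p < 13 / 8 -> 7 / 10 <= a <= 1 ->
  a <= d <= 1 -> 0 <= b -> d + b <= 1 ->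
  (1 - d) * (p * (d + b) - a) <= a ^+ 2 * (p - 1).
Proof.
move=> p2 /andP[p0 p1] /andP[a0 a1] /andP[d0 d1] b0 db.
have : (1 - d) * (p * (d + b) - a) <= (1 - a) * (p - a).
  by apply: ler_pM; nra.
nra.
Qed.
(** For [l >= 3] only [a >= 5 / 8] is at hand, but [beta] is at most a third of [1 - a], and the
    left side becomes a concave quadratic in [d - a]. *)
Lemma step_bound_large (F : realFieldType) (p a b d : F) :
  p ^+ 2 = p + 1 -> 8 / 5 < p < 13 / 8 -> 5 / 8 <= a <= 1 ->
  a <= d <= 1 -> 0 <= b -> b <= (1 - a) / 3 ->
  (1 - d) * (p * (d + b) - a) <= a ^+ 2 * (p - 1).
Proof.
move=> p2 /andP[p0 p1] /andP[a0 a1] /andP[d0 d1] b0 db.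
have : (1 - d) * (p * (d + b) - a) <= (1 - d) * (p * (d + (1 - a) / 3) - a).
  by apply: ler_wpM2l; nra.
(* With [e = d - a] and [b = (1 - a) / 3] the product is [(1 - a) * (p * (1 + 2 * a) / 3 - a)] plus
   [e] times this coefficient minus [p * e ^+ 2]. The value 1/40 is the coefficient at [a = 5 / 8],
   [p = 8 / 5]. *)
have S0 : p * (2 / 3 - 5 / 3 * a) + a <= 1 / 40 by nra.
have : (d - a) * (p * (2 / 3 - 5 / 3 * a) + a) - p * (d - a) ^+ 2 <= 1 / 100.
  have : (d - a) * (p * (2 / 3 - 5 / 3 * a) + a) <= (d - a) * (1 / 40).
    by apply: ler_wpM2l; lra.
  have : 8 / 5 * (d - a) ^+ 2 <= p * (d - a) ^+ 2 by rewrite ler_wpM2r ?sqr_ge0//; lra.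
  (* [e = 1 / 128] maximises [e / 40 - 8 / 5 * e ^+ 2]. *)
  have := sqr_ge0 (d - a - 1 / 128); move: (d - a) => e; nra.
have : (1 - a) * (p * (1 + 2 * a) / 3 - a) + 1 / 100 <= a ^+ 2 * (p - 1) by nra.
lra.
Qed.

(** * Numerical bounds on [phi] and [alpha] *)

Section GCLAnalysis.
Variables (R : realType) (m l : nat).
Hypotheses (m_ge2 : (2 <= m)%N) (l_gt0 : (1 <= l)%N).

Local Notation phi := (phi R).
Local Notation alpha := (alpha R m l).
Local Notation beta := (beta R m l).
Local Notation y_ := (y_ R m l).
Local Notation x_ := (x_ R m l).
Local Notation w := (@gcl_weight R m l).
Local Notation c := (1 - m%:R^-1 : R).
Local Notation k := (1 + l%:R^-1 : R).

Lemma phi_sqr : phi ^+ 2 = phi + 1.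
Proof.
have : Num.sqrt 5 ^+ 2 = 5 :> R by rewrite sqr_sqrtr.
rewrite /Defs.phi; move: (Num.sqrt 5) => s; lra.
Qed.

Lemma phi_bounds : 8 / 5 < phi < 13 / 8.
Proof.
have := phi_sqr; have : 0 <= Num.sqrt 5 :> R := sqrtr_ge0 _.
have : 1 / 2 <= phi by rewrite /Defs.phi; have := sqrtr_ge0 (5 : R); lra.
move: phi => p *; apply/andP; split; nra.
Qed.

Lemma phi_inv : phi^-1 = phi - 1.
Proof.
have /andP[p0 _] := phi_bounds; have := phi_sqr => p2.
by apply: (@mulfI _ phi); rewrite ?gt_eqF ?mulfV ?gt_eqF//; lra.
Qed.

Lemma c_bounds : 1 / 2 <= c < 1.
Proof.
have m0 : 0 < m%:R :> R by rewrite ltr0n ltnW.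
have : 0 < m%:R^-1 :> R by rewrite invr_gt0.
have : m%:R^-1 <= 2^-1 :> R by rewrite lef_pV2 ?posrE// ler_nat.
lra.
Qed.

Lemma k_gt1 : 1 < k.
Proof. by rewrite ltrDl invr_gt0 ltr0n. Qed.

Lemma ck_phi_gt0 : 0 < c * k * phi.
Proof.
have /andP[c0 _] := c_bounds; have /andP[p0 _] := phi_bounds; have := k_gt1.
by move=> k1; rewrite !mulr_gt0//; lra.
Qed.

(** Dividing both terms of the fraction under the root by [l * phi] gives this form. It is the
    stationarity condition in [a] of [a / phi + c * k * phi * (1 - a) ^+ 2 / (2 * a)], the part of
    the ratio bound that varies with [alpha]. *)
Lemma alpha_sqr : alpha ^+ 2 * (c * k * phi + 2 / phi) = c * k * phi.
Proof.
have l0 : 0 < l%:R :> R by rewrite ltr0n.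
have q0 := ck_phi_gt0; have /andP[p0 _] := phi_bounds.
have phi0 : 0 < phi by lra.
have numE : c * (l%:R + 1) * phi ^+ 2 = c * k * phi * (l%:R * phi).
  by move: c => d; field; rewrite gt_eqF.
rewrite /Defs.alpha numE; move: (c * k * phi) q0 => q q0.
have lp0 : 0 < l%:R * phi by exact: mulr_gt0.
have qlp0 : 0 < q * (l%:R * phi) by exact: mulr_gt0.
rewrite sqr_sqrtr ?divr_ge0//; try by lra.
by field; rewrite !gt_eqF//; nra.
Qed.

(** By [alpha_sqr], [alpha ^+ 2 = q / (q + 2 / phi)] increases with [q = c * k * phi], and
    [q >= phi / 2] because [c >= 1 / 2] and [k > 1]. *)
Lemma alpha_bounds : 5 / 8 < alpha < 1.
Proof.
have a0 : 0 <= alpha := sqrtr_ge0 _.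
have /andP[c0 c1] := c_bounds; have /andP[p0 p1] := phi_bounds.
have p2 := phi_sqr; have k1 := k_gt1.
have := alpha_sqr; have q0 := ck_phi_gt0.
have q1 : 1 / 2 * phi <= c * k * phi by rewrite ler_pM2r; [nra|lra].
rewrite phi_inv; move: (c * k * phi) q0 q1 => q q0 q1 aE.
have b2 : (5 / 8) ^+ 2 < alpha ^+ 2.
  rewrite -(ltr_pM2r (_ : 0 < q + 2 * (phi - 1))) ?aE; lra.
have b3 : alpha ^+ 2 < 1 ^+ 2.
  rewrite expr1n -(ltr_pM2r (_ : 0 < q + 2 * (phi - 1))) ?aE; lra.
by rewrite !ltr_pXn2r ?nnegrE// in b2 b3; rewrite ?b2//; lra.
Qed.

(** Now [k >= 3 / 2], so [q >= 3 / 4 * phi], just enough for [step_bound_small]. *)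
Lemma alpha_ge_small_l : (l <= 2)%N -> 7 / 10 <= alpha.
Proof.
move=> l2; have a0 : 0 <= alpha := sqrtr_ge0 _.
have /andP[c0 c1] := c_bounds; have /andP[p0 p1] := phi_bounds.
have p2 := phi_sqr; have := alpha_sqr; have q0 := ck_phi_gt0.
have k1 : 3 / 2 <= k.
  have : 2^-1 <= l%:R^-1 :> R by rewrite lef_pV2 ?posrE ?ltr0n// ler_nat.
  lra.
have q1 : 3 / 4 * phi <= c * k * phi by rewrite ler_pM2r; [nra|lra].
rewrite phi_inv; move: (c * k * phi) q0 q1 => q q0 q1 aE.
rewrite -(ler_pXn2r (n := 2)) ?nnegrE//.
rewrite -(ler_pM2r (_ : 0 < q + 2 * (phi - 1))) ?aE; lra.
Qed.

(* [1 - a] is the probability of leaving untested a job whose ratio lies in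
   (y_i, y_(i+1)], where a = alpha + i beta; its ratio is at most y_(i+1). *)
Lemma step_bound (a : R) : alpha <= a -> a + beta <= 1 ->
  (1 - a) * (phi * (a + beta) / alpha) + a <= 1 + alpha / phi.
Proof.
have /andP[a0 a1] := alpha_bounds; have /andP[p0 p1] := phi_bounds => aa ab.
have l0 : 0 < l%:R :> R by rewrite ltr0n.
have b0 : 0 <= beta by rewrite divr_ge0//; lra.
suff H : (1 - a) * (phi * (a + beta) - alpha) <= alpha ^+ 2 * (phi - 1).
  rewrite phi_inv -subr_ge0 -(pmulr_rge0 _ (_ : 0 < alpha)); last by lra.
  set X := _ * (_ - _).
  have -> : X = alpha ^+ 2 * (phi - 1) - (1 - a) * (phi * (a + beta) - alpha).
    by rewrite /X; field; rewrite gt_eqF//; lra.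
  by rewrite subr_ge0.
have [l2|l3] := leqP l 2.
  by apply: step_bound_small; have := alpha_ge_small_l l2; have := phi_sqr; lra.
apply: step_bound_large; rewrite ?phi_sqr//; try by lra.
by rewrite ler_wpM2l ?lef_pV2 ?posrE ?ler_nat//; lra.
Qed.

(** * Monotonicity of the thresholds *)

Lemma beta_gt0 : 0 < beta.
Proof. by have /andP[_ a1] := alpha_bounds; rewrite divr_gt0 ?ltr0n//; lra. Qed.

Lemma lbeta : l%:R * beta = 1 - alpha.
Proof. by rewrite /Defs.beta mulrC divfK// pnatr_eq0 -lt0n. Qed.

Lemma untested_mass_le1 (i : nat) : (i <= l)%N -> alpha + i%:R * beta <= 1.
Proof.
move=> il; have : i%:R * beta <= l%:R * beta.
  by rewrite ler_wpM2r ?ler_nat// ltW// beta_gt0.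
by rewrite lbeta; lra.
Qed.

Lemma y_homo : {homo y_ : i j / (i <= j)%N >-> i <= j}.
Proof.
move=> i j ij; have /andP[a0 _] := alpha_bounds; have /andP[p0 _] := phi_bounds.
rewrite /Defs.y_ ler_wpM2r ?invr_ge0 ?ler_wpM2l//; try by lra.
by rewrite lerD2l ler_wpM2r ?ler_nat// ltW// beta_gt0.
Qed.

Lemma y_0 : y_ 0 = phi.
Proof.
have /andP[a0 _] := alpha_bounds.
by rewrite /Defs.y_ mul0r addr0 mulfK// gt_eqF//; lra.
Qed.

Lemma phi_le_y (i : nat) : phi <= y_ i.
Proof. by rewrite -y_0 y_homo. Qed.

Lemma y_gt0 (i : nat) : 0 < y_ i.
Proof. by have := phi_le_y i; have /andP[] := phi_bounds; lra. Qed.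

Lemma x_homo : {homo x_ : i j / (i <= j)%N >-> j <= i}.
Proof.
by move=> i j ij; rewrite /Defs.x_ lerD2l lef_pV2 ?posrE ?y_gt0// y_homo.
Qed.

(** Since [1 + 1 / phi = phi], both thresholds of [A_0] equal [phi]: it tests exactly the jobs of
    ratio above [phi]. *)
Lemma x_0 : x_ 0 = phi.
Proof. by rewrite /Defs.x_ y_0 phi_inv; ring. Qed.

Lemma x_le_phi (i : nat) : x_ i <= phi.
Proof. by rewrite -x_0 x_homo. Qed.

Lemma x_gt1 (i : nat) : 1 < x_ i.
Proof. by rewrite /Defs.x_ ltrDl invr_gt0 y_gt0. Qed.

(** * Expectations over the random choice of algorithm *)

Lemma sum_gcl_weight_le (i : nat) : (i <= l)%N ->
  \sum_(j < l.+1 | (j <= i)%N) w j = alpha + i%:R * beta.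
Proof.
move=> il; rewrite big_mkcond big_ord_recl /= /gcl_weight eqxx; congr (_ + _).
rewrite -big_mkcond /= (eq_bigr (fun=> beta)); last by move=> j _.
by rewrite -(big_ord_widen l (fun=> beta)) // sumr_const card_ord mulr_natl.
Qed.

Lemma expectation_split (i : nat) (f : 'I_l.+1 -> R) (a b : R) : (i <= l)%N ->
  (forall j : 'I_l.+1, f j = if (j <= i)%N then a else b) ->
  \sum_j w j * f j =
    (alpha + i%:R * beta) * a + (1 - (alpha + i%:R * beta)) * b.
Proof.
move=> il fE; have := gcl_weight_sum1 R m l_gt0.
rewrite (bigID (fun j : 'I_l.+1 => (j <= i)%N)) /= sum_gcl_weight_le// => sum1.
rewrite (bigID (fun j : 'I_l.+1 => (j <= i)%N)) /=.
rewrite (eq_bigr (fun j => w j * a)); last by move=> j ji; rewrite fE ji.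
rewrite [X in _ + X](eq_bigr (fun j => w j * b)); last first.
  by move=> j /negbTE ji; rewrite fE ji.
rewrite -!mulr_suml sum_gcl_weight_le//; congr (_ + _ * _).
by lra.
Qed.

Lemma expected_y : \sum_j w j * y_ j = phi * (1 + (1 - alpha) ^+ 2 * k / (2 * alpha)).
Proof.
have /andP[a0 a1] := alpha_bounds.
(* Once index 0 is split off, [j] stands for the algorithm of index [j + 1], whose term is affine in
   [j]. *)
rewrite big_ord_recl /gcl_weight eqxx (eq_bigr (fun j : 'I_l =>
  beta * (phi * (alpha + beta) / alpha) + (beta ^+ 2 * phi / alpha) * j%:R)).
  rewrite big_split /= sumr_const card_ord y_0 -mulr_sumr.
  have -> : \sum_(i < l) (i%:R : R) = l%:R * (l%:R - 1) / 2.
    elim: l => [|n IH]; first by rewrite big_ord0 mul0r mul0r.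
    by rewrite big_ord_recr /= IH -natr1; field.
  rewrite -mulr_natl -[beta]/((1 - alpha) / l%:R).
  by field; rewrite pnatr_eq0 -lt0n l_gt0 gt_eqF//; lra.
move=> j _; rewrite /Defs.y_ /= /bump add1n -natr1.
by field; rewrite gt_eqF//; lra.
Qed.

(** * Cost of a single job *)

Definition gcl_tests (i : nat) (u t : R) : bool := ~~ leaves_untested m l i u t.

Lemma gcl_testsE (i : nat) (u t : R) : 0 < t ->
  gcl_tests i u t = if u <= phi * t then x_ i * t < u else y_ i * t < u.
Proof.
move=> t0; rewrite /gcl_tests /leaves_untested /job_ratio gt_eqF//.
rewrite lte_fin !lee_fin ltr_pdivlMr// !ler_pdivrMr// !ltNge.
case: (leP u (phi * t)) => [_|up]; first by rewrite /= orbF.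
have : x_ i * t <= phi * t by rewrite ler_pM2r// x_le_phi.
by case: (leP u (x_ i * t)) => //= ? ?; lra.
Qed.

Lemma gcl_tests_untimed (i : nat) (u : R) : gcl_tests i u 0 = (u != 0).
Proof.
rewrite /gcl_tests /leaves_untested /job_ratio eqxx.
case: eqP => _ /=; last by rewrite !leye_eq /= andbF.
by rewrite lee_fin (ltW (lt_trans ltr01 (x_gt1 i))).
Qed.

(** A free test leaves cost [p <= u]; the only untested case is [u = 0], where [p = 0] as well. *)
Lemma processing_cost_untimed (i : nat) (j : job R) : valid_job j ->
  test_time j = 0 -> processing_cost (gcl_tests i) j = rho j.
Proof.
move=> /and4P[u0 _ p0 pu] t0; rewrite /processing_cost /rho t0 gcl_tests_untimed.
rewrite add0r min_r//; case: eqP => //= uE; lra.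
Qed.

Lemma processing_cost_ge0 (i : nat) (j : job R) : valid_job j ->
  0 <= processing_cost (gcl_tests i) j.
Proof. by case/and4P => *; rewrite /processing_cost; case: ifP => _; lra. Qed.

(** An untested job has [u <= y_i * t] in both ranges of the ratio. A tested one needs
    [t <= (y_i - 1) * u]: for ratios up to [phi] this comes from [x_i * y_i = y_i + 1] and
    [x_i <= y_i], for larger ones from [y_i ^+ 2 >= y_i + 1]. *)
Lemma processing_cost_le (i : nat) (j : job R) : valid_job j ->
  processing_cost (gcl_tests i) j <= y_ i * rho j.
Proof.
move=> jv; have [u0 t0 p0 pu] := and4P jv.
have /andP[q0 q1] := phi_bounds; have yp := phi_le_y i; have q2 := phi_sqr.
have := t0; rewrite le_eqVlt => /predU1P[/esym t00|tp].
  rewrite processing_cost_untimed// -[leLHS]mul1r ler_wpM2r ?rho_ge0//; lra.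
have xy : x_ i * y_ i = y_ i + 1.
  by rewrite /Defs.x_ mulrDl mul1r mulVf// gt_eqF// y_gt0.
have y2 : y_ i + 1 <= y_ i ^+ 2 by nra.
have := x_gt1 i; have := x_le_phi i.
rewrite /processing_cost gcl_testsE// /rho.
move: (y_ i) (x_ i) (upper j) (test_time j) (proc j)
  => y x u t p in yp u0 t0 p0 pu tp xy y2 *.
move=> xp x1.
rewrite minr_pMr; last by lra.
rewrite le_min; case: (leP u (phi * t)) => up; case: ifPn; rewrite -?leNgt => xu.
- have : (y - 1) * (x * t) <= (y - 1) * u by rewrite ler_wpM2l//; lra.
  have : t <= (y - 1) * (x * t).
    have -> : (y - 1) * (x * t) = (x * y - x) * t by ring.
    by rewrite xy ler_peMl//; lra.
  by move=> ? ?; apply/andP; split; nra.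
- by apply/andP; split; nra.
- have : (y - 1) * (y * t) <= (y - 1) * u by rewrite ler_wpM2l//; lra.
  have : t <= (y - 1) * (y * t).
    have -> : (y - 1) * (y * t) = (y ^+ 2 - y) * t by ring.
    by rewrite ler_peMl//; lra.
  by move=> ? ?; apply/andP; split; nra.
- by apply/andP; split; nra.
Qed.

Lemma expected_processing_cost (j : job R) : valid_job j ->
  \sum_(i < l.+1) w i * processing_cost (gcl_tests i) j <= (1 + alpha / phi) * rho j.
Proof.
move=> jv; have [u0 t0 p0 pu] := and4P jv.
have /andP[q0 q1] := phi_bounds; have /andP[a0 a1] := alpha_bounds.
have ap0 : 0 < alpha / phi by rewrite divr_gt0//; lra.
have := t0; rewrite le_eqVlt => /predU1P[/esym t00|tp].
  rewrite (eq_bigr (fun i => w i * rho j)); last first.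
    by move=> i _; rewrite processing_cost_untimed.
  rewrite -mulr_suml gcl_weight_sum1// ler_wpM2r ?rho_ge0//; lra.
have yE i : y_ i * alpha = phi * (alpha + i%:R * beta).
  by rewrite /Defs.y_ divfK// gt_eqF//; lra.
have [up|pu'] := leP (upper j) (phi * test_time j).
(* Ratio at most [phi]: the indices up to [i] leave the job untested, with total probability [a]
   below. *)
- have [|i i' ii'|i il iP] :=
    @prefix_threshold (fun i => upper j <= x_ i * test_time j) l.
  + by rewrite x_0.
  + by move=> /le_trans; apply; rewrite ler_pM2r// x_homo.
  rewrite (@expectation_split i _ (upper j) (test_time j + proc j))//; last first.
    move=> i'; rewrite /processing_cost gcl_testsE// up ltNge iP ?if_neg//.
    by rewrite -ltnS.
  set a := _ + _ * beta.
  have aa : alpha <= a by rewrite lerDl mulr_ge0 ?ler0n// ltW// beta_gt0.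
  have a_le1 : a <= 1 := untested_mass_le1 il.
  (* [x_i = 1 + 1 / y_i] is tuned so that [a / y_i = alpha / phi]. *)
  have ax : a * x_ i = a + alpha / phi.
    have aE : a = y_ i * (alpha / phi).
      by rewrite mulrA yE mulrAC mulfV ?mul1r// lt0r_neq0//; lra.
    rewrite /Defs.x_ mulrDr mulr1 [in X in _ + X]aE.
    by rewrite mulrAC mulfV ?mul1r// lt0r_neq0// y_gt0.
  have ux : a * upper j <= (a + alpha / phi) * test_time j.
    by rewrite -ax -mulrA ler_wpM2l ?iP//; lra.
  (* If [i = l], then [a = 1]. Otherwise [t <= x_(i+1) * t < u], and
     [1 - a <= 1 - alpha <= alpha / phi] because [alpha * phi >= 1]. *)
  have tu : (1 - a) * test_time j <= alpha / phi * upper j.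
    have [iE|il'] := eqVneq i l.
      by rewrite /a iE lbeta subrKC subrr mul0r mulr_ge0// ltW.
    have il1 : (i < l)%N by rewrite ltn_neqAle il' il.
    have := iP _ il1; rewrite ltnn => /negbT; rewrite -ltNge => xu.
    apply: ler_pM => //; first by rewrite subr_ge0.
      by rewrite phi_inv; nra.
    by apply: ltW (le_lt_trans _ xu); rewrite ler_peMl// ltW// x_gt1.
  have r0 : 0 <= alpha / phi * proc j by rewrite mulr_ge0// ltW.
  have ap : 0 <= a * proc j by rewrite mulr_ge0//; lra.
  have bp : (1 - a) * proc j <= (1 - a) * upper j by rewrite ler_wpM2l ?subr_ge0.
  rewrite /rho minr_pMr ?le_min; last by lra.
  by apply/andP; split; lra.
(* Ratio above [phi]: now the indices up to [i] are those that test. *)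
- have [|i i' ii'|i il iP] :=
    @prefix_threshold (fun i => y_ i * test_time j < upper j) l.
  + by rewrite y_0.
  + by apply: le_lt_trans; rewrite ler_pM2r// y_homo.
  rewrite (@expectation_split i _ (test_time j + proc j) (upper j))//; last first.
    move=> i'; rewrite /processing_cost gcl_testsE// leNgt pu' /= iP//.
    by rewrite -ltnS.
  set a := _ + _ * beta.
  have a_le1 : a <= 1 := untested_mass_le1 il.
  have aa : alpha <= a by rewrite lerDl mulr_ge0 ?ler0n// ltW// beta_gt0.
  have tu : a * test_time j <= alpha / phi * upper j.
    have := iP _ il; rewrite leqnn => yu.
    rewrite mulrAC ler_pdivlMr; last by lra.
    by rewrite mulrAC (mulrC a) -yE (mulrC (y_ i)) -mulrA ler_wpM2l ?ltW//; lra.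
  (* If [i = l], every algorithm tests and [a = 1]. Otherwise [u <= y_(i+1) * t], and [step_bound]
     applies. *)
  have ut : (1 - a) * upper j <= (1 + alpha / phi - a) * test_time j.
    have [iE|il'] := eqVneq i l.
      have -> : a = 1 by rewrite /a iE lbeta subrKC.
      by rewrite subrr mul0r mulr_ge0//; lra.
    have il1 : (i < l)%N by rewrite ltn_neqAle il' il.
    have aSi : alpha + i.+1%:R * beta = a + beta.
      by rewrite /a -natr1 mulrDl mul1r addrA.
    have := iP _ il1; rewrite ltnn => /negbT; rewrite -leNgt /Defs.y_ aSi => uy.
    have ab : a + beta <= 1 by rewrite -aSi untested_mass_le1.
    apply: (@le_trans _ _ ((1 - a) * (phi * (a + beta) / alpha * test_time j))).
      by rewrite ler_wpM2l// subr_ge0.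
    by rewrite mulrA ler_wpM2r//; have := step_bound aa ab; lra.
  have r0 : 0 <= alpha / phi * proc j by rewrite mulr_ge0// ltW.
  have ap : a * proc j <= a * upper j by rewrite ler_wpM2l//; lra.
  have bp : 0 <= (1 - a) * proc j by rewrite mulr_ge0// subr_ge0.
  rewrite /rho minr_pMr ?le_min; last by lra.
  by apply/andP; split; lra.
Qed.

(** * Closed form of the ratio *)

Lemma gcl_ratio_bound :
  Num.sqrt (c ^+ 2 * k ^+ 2 * phi ^+ 2 + 2 * c * k) + 1 - c * (phi / l%:R) =
  1 + alpha / phi + c * \sum_(j < l.+1) w j * y_ j.
Proof.
have /andP[p0 p1] := phi_bounds; have /andP[a0 a1] := alpha_bounds.
have q0 := ck_phi_gt0; have a2 := alpha_sqr.
have phi0 : phi != 0 by rewrite lt0r_neq0//; lra.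
have alpha0 : alpha != 0 by rewrite lt0r_neq0//; lra.
(* With [q = c * k * phi], [alpha_sqr] turns the square of the right side into [q * (q + 2 / phi)],
   which is the radicand. *)
have sqrtE : Num.sqrt (c ^+ 2 * k ^+ 2 * phi ^+ 2 + 2 * c * k) =
    alpha * (c * k * phi + 2 / phi).
  have -> : c ^+ 2 * k ^+ 2 * phi ^+ 2 + 2 * c * k =
      (alpha * (c * k * phi + 2 / phi)) ^+ 2.
    move: c k a2 => d e a2.
    have -> : (alpha * (d * e * phi + 2 / phi)) ^+ 2 =
        alpha ^+ 2 * (d * e * phi + 2 / phi) * (d * e * phi + 2 / phi) by ring.
    by rewrite a2; field.
  rewrite sqrtr_sqr ger0_norm// mulr_ge0//; first by lra.
  by rewrite addr_ge0 ?divr_ge0//; lra.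
rewrite sqrtE expected_y.
have lk : c * (phi / l%:R) = c * k * phi - c * phi.
  by move: c => d; field; rewrite pnatr_eq0 -lt0n.
have expand : c * (phi * (1 + (1 - alpha) ^+ 2 * k / (2 * alpha))) =
    c * phi + c * k * phi * ((1 - alpha) ^+ 2 / (2 * alpha)).
  by move: c k => d e; field.
rewrite lk expand; move: (c * k * phi) (c * phi) a2 => q d a2.
have qE : q / (2 * alpha) = alpha * (q + 2 / phi) / 2.
  by rewrite -[in LHS]a2; field; rewrite phi0.
have -> : q * ((1 - alpha) ^+ 2 / (2 * alpha)) =
    q / (2 * alpha) - q + alpha * q / 2 by field.
rewrite qE; lra.
Qed.

End GCLAnalysis.

(** * Assembling the competitive ratio *)

Theorem theorem1 (R : realType) (m l : nat) (hm : (2 <= m)%N) (hl : (1 <= l)%N)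
    (sel : 'I_l.+1 -> selector R m) (hsel : forall i, least_loaded (sel i)) :
  (expected_competitive_ratio (GCL hl sel) <=
    (Num.sqrt ((1 - m%:R^-1) ^+ 2 * (1 + l%:R^-1) ^+ 2 * phi R ^+ 2
               + 2 * (1 - m%:R^-1) * (1 + l%:R^-1))
     + 1 - (1 - m%:R^-1) * (phi R / l%:R))%:E)%E.
Proof.
rewrite gcl_ratio_bound//.
set B := 1 + _ + _.
have m0 : (0 < m)%N by exact: ltnW.
have mV0 : 0 <= m%:R^-1 :> R by rewrite invr_ge0.
have /andP[c0 _] := c_bounds R hm.
have /andP[p0 _] := phi_bounds R; have /andP[a0 _] := alpha_bounds R hm hl.
have r0 : 0 <= 1 + alpha R m l / phi R by rewrite addr_ge0 ?divr_ge0//; lra.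
have B0 : 0 <= B.
  rewrite addr_ge0// mulr_ge0 ?sumr_ge0// => [|i _]; first by lra.
  by rewrite mulr_ge0 ?gcl_weight_ge0// ltW// y_gt0.
apply: ge_ereal_sup => _ [I /= Ivalid <-].
have opt0 := opt_ge0 I m0.
have costB : expected_cost (GCL hl sel) I <= B * opt m I.
  have costA (i : 'I_l.+1) : cost (A_ l i (sel i)) I <=
      m%:R^-1 * (\sum_(j <- I) processing_cost (@gcl_tests R m l i) j) +
      (1 - m%:R^-1) * (y_ R m l i * opt m I).
    apply: cost_list_scheduling => //.
      by move=> h u t k'; apply: hsel.
    - by rewrite mulr_ge0// ltW// y_gt0.
    (* The optimum is generalised to a fixed [o] so that it does not change during the induction on
       the instance. *)
    - have := rho_le_opt m0 Ivalid; move: Ivalid (opt m I) => {opt0} Iv o.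
      elim: I Iv => //= j I IH /andP[jv Iv] /andP[jo Io].
      rewrite processing_cost_ge0// IH// andbT.
      apply: (le_trans (processing_cost_le hm hl i jv)).
      by rewrite ler_wpM2l// ltW// y_gt0.
  apply: (@le_trans _ _ (m%:R^-1 * ((1 + alpha R m l / phi R) * \sum_(j <- I) rho j)
    + (1 - m%:R^-1) * (\sum_(i < l.+1) gcl_weight R m i * y_ R m l i) * opt m I)).
    apply: (@le_trans _ _ (\sum_(i < l.+1) gcl_weight R m i *
      (m%:R^-1 * (\sum_(j <- I) processing_cost (@gcl_tests R m l i) j) +
      (1 - m%:R^-1) * (y_ R m l i * opt m I)))).
      by apply: ler_sum => i _; apply: ler_wpM2l (costA i); exact: gcl_weight_ge0.
    under eq_bigr do rewrite mulrDr mulrCA [X in _ + X]mulrCA (mulrA _ (y_ _ _ _ _)).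
    rewrite big_split /= -!mulr_sumr -mulr_suml mulrA lerD2r ler_wpM2l//.
    under [leLHS]eq_bigr do rewrite mulr_sumr.
    (* With the sum over jobs outermost, the expected cost is bounded job by job. *)
    rewrite exchange_big /=; move: Ivalid.
    elim: I {opt0 costA} => [|j I IH] /=; first by rewrite !big_nil mulr0.
    move=> /andP[jv Iv]; rewrite !big_cons mulrDr lerD ?IH//.
    exact: expected_processing_cost.
  rewrite /B [leRHS]mulrDl lerD2r mulrCA ler_wpM2l//.
  exact: average_rho_le_opt.
(* When the optimum is 0, [costB] forces the expected cost to be 0, and the quotient is 0 by
   convention. *)
have [optE|opt_neq0] := eqVneq (opt m I) 0.
  have -> : expected_cost (GCL hl sel) I = 0.
    apply/eqP; rewrite eq_le; apply/andP; split.
      by rewrite (le_trans costB)// optE mulr0.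
    apply: sumr_ge0 => i _; rewrite mulr_ge0 ?weight_ge0//.
    exact: bigmax_ge_id.
  by rewrite mul0e lee_fin.
by rewrite inver (negbTE opt_neq0) -EFinM lee_fin ler_pdivrMr// lt0r opt_neq0.
Qed.
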